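(* Let $N\ge3$, $\beta\in\mathbb{R}$, $p_\beta^*=\frac{N+\beta}{N-2}$, and let $h(x,u)=|x|^\beta(\ln|x|)^\tau u^p$. Suppose that one of the following conditions is satisfied: (i) $p>p_\beta^*$ and $\tau\in\mathbb{R}$; (ii) $p=p_\beta^*$ and $\tau<-1$. Then for some large $\ell>e$, the problem $$-\Delta u=h(x,u)\ \text{ in }\Omega,\qquad u\ge0\ \text{ on }\partial\Omega,$$ with $\Omega=\mathbb{R}^N\setminus B_\ell(0)$, has a positive bounded supersolution.
   Context: $B_\ell(0)$ is the ball of radius $\ell$ centered at the origin ($e$ is Euler's number). A function $u\in C^2(\Omega)$ is a positive supersolution of the problem if $u(x)>0$ and $-\Delta u(x)\ge h(x,u(x))$ for all $x\in\Omega$ (the boundary condition being $u\ge0$ on $\partial\Omega$); it is a positive bounded supersolution if moreover $u$ is bounded in $\Omega$. *)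

(* Defs.v *)
From HB Require Import structures.
From mathcomp Require Import all_boot all_order all_algebra.
From mathcomp Require Import all_classical all_reals all_analysis.

Set Implicit Arguments.
Unset Strict Implicit.
Unset Printing Implicit Defensive.

Import Order.TTheory GRing.Theory Num.Theory.
Import numFieldNormedType.Exports.

Local Open Scope classical_set_scope.
Local Open Scope ring_scope.

(* The library norm on 'rV[R]_N is the sup norm, so the Euclidean norm has to be
   introduced separately; the two induce the same topology. *)
Definition enorm (R : realType) (N : nat) (x : 'rV[R]_N) : R :=
  Num.sqrt (\sum_(i < N) x ord0 i ^+ 2).

Definition partial (R : realType) (N : nat) (i : 'I_N) (u : 'rV[R]_N -> R) :
    'rV[R]_N -> R :=
  fun x => 'D_(delta_mx ord0 i) u x.

Definition partial_derivable (R : realType) (N : nat) (i : 'I_N)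
    (u : 'rV[R]_N -> R) (x : 'rV[R]_N) : Prop :=
  derivable u x (delta_mx ord0 i).

Definition laplacian (R : realType) (N : nat) (u : 'rV[R]_N -> R)
    (x : 'rV[R]_N) : R :=
  \sum_(i < N) partial i (partial i u) x.

(* Meant for open Omega: continuity and derivability are taken with respect to
   full neighbourhoods of the points of Omega. *)
Definition C2_on (R : realType) (N : nat) (Omega : set 'rV[R]_N)
    (u : 'rV[R]_N -> R) : Prop :=
  forall x, Omega x ->
    [/\ {for x, continuous u},
        forall i : 'I_N,
          partial_derivable i u x /\ {for x, continuous (partial i u)}
      & forall i j : 'I_N,
          partial_derivable j (partial i u) x /\
          {for x, continuous (partial j (partial i u))}].

Definition boundary (T : topologicalType) (A : set T) : set T :=
  closure A `\` interior A.

(* Functions are total, so u comes with values outside Omega; continuity on the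
   closure of Omega makes its values on the boundary the actual boundary values
   of the restriction of u to Omega. *)
Definition positive_supersolution (R : realType) (N : nat)
    (Omega : set 'rV[R]_N) (h : 'rV[R]_N -> R -> R) (u : 'rV[R]_N -> R) : Prop :=
  [/\ C2_on Omega u,
      {within closure Omega, continuous u},
      forall x, Omega x -> 0 < u x,
      forall x, Omega x -> h x (u x) <= - laplacian u x
    & forall x, boundary Omega x -> 0 <= u x].

Definition positive_bounded_supersolution (R : realType) (N : nat)
    (Omega : set 'rV[R]_N) (h : 'rV[R]_N -> R -> R) (u : 'rV[R]_N -> R) : Prop :=
  positive_supersolution Omega h u /\ [bounded u x | x in Omega].

(* The removed ball is closed, so that the exterior domain is open. *)
Definition exterior_domain (R : realType) (N : nat) (l : R) : set 'rV[R]_N :=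
  ~` [set x : 'rV[R]_N | enorm x <= l].
Arguments exterior_domain {R} N l.

Definition log_weight_nonlinearity (R : realType) (N : nat) (beta tau p : R)
    (x : 'rV[R]_N) (u : R) : R :=
  enorm x `^ beta * ln (enorm x) `^ tau * u `^ p.

Definition critical_exponent (R : realType) (N : nat) (beta : R) : R :=
  (N%:R + beta) / (N%:R - 2).

(* Main.v *)
Require Import Defs.
From mathcomp Require Import all_boot all_order all_algebra.
From mathcomp Require Import all_classical all_reals all_analysis.
From mathcomp Require Import ring lra.

Set Implicit Arguments.
Unset Strict Implicit.
Unset Printing Implicit Defensive.

Import Order.TTheory GRing.Theory Num.Theory.
Import numFieldNormedType.Exports.

Local Open Scope classical_set_scope.
Local Open Scope ring_scope.

(** Write m = N - 2, r = |x| and t = ln r.  For a radial function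
u(x) = G(ln r) the Laplacian is r^-2 (G''(t) + m G'(t))
([laplacian_log_radial]), so that the partial differential inequality becomes
e^((beta + 2) t) t^tau G^p <= - (G'' + m G'), required only for large t
([log_radial_supersolution]).  The fundamental solution r^-m, that is
G = e^(-m t), makes the right-hand side vanish; a supersolution is a slight
perturbation of it.  Take G(t) = e^(-s t) g(t) with 1 <= g <= 2; dividing by
e^(-s t) leaves
[e^(-(s (p - 1) - (beta + 2)) t) t^tau g^p
   <= s (m - s) g - (m - 2 s) g' - g'']
([twisted_supersolution]).

- If p is supercritical, then m (p - 1) > beta + 2.  This persists for some s
  slightly below m.  With g = 1 the right-hand side is the positive constant
  s (m - s), while on the left an exponential decay beats the power t^tau.
- If p is critical and tau < -1, take s = m: the exponential on the left
  disappears and the right-hand side is m g' - g''.  With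
  g = 2 - t^(-eps) it is at least eps t^(-eps - 1), and
  eps = - (tau + 1) / 2 makes tau = - eps - 1 - eps, so the left-hand side is
  smaller by the factor t^(-eps), up to a constant.

In both cases p may be of any sign, because g stays between two positive
constants. *)

(** * Chain rule and continuity *)

(** Carries the chain rule for functions of one real variable over to
directional derivatives. *)
Lemma is_derive_lineP (R : realType) (V : normedModType R) (f : V -> R)
    (x v : V) (d : R) :
  is_derive (0 : R) 1 (fun h : R => f (h *: v + x)) d <-> is_derive x v f d.
Proof.
have E : 'D_1 (fun h : R => f (h *: v + x)) (0 : R) = 'D_v f x.
  rewrite /derive; set F1 := (fun h : R => _ *: _).
  set F2 := (fun h : R => _ *: _).
  suff -> : F1 = F2 by [].
  apply/funext => h; rewrite /F1 /F2 /=.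
  by rewrite addr0 scale0r add0r [h *: 1]mulr1.
split=> -[df dE]; apply: DeriveDef.
- exact: (derivable1P _ _ _).2.
- by rewrite -dE -E.
- exact: (derivable1P _ _ _).1.
- by rewrite E dE.
Qed.

Lemma is_derive_comp_real (R : realType) (V : normedModType R) (f : V -> R)
    (g : R -> R) (x v : V) (a d : R) :
  is_derive (f x) 1 g a -> is_derive x v f d ->
  is_derive x v (g \o f) (a * d).
Proof.
move=> dg /is_derive_lineP df; apply/is_derive_lineP.
apply: (@is_derive1_comp R g (fun h : R => f (h *: v + x))) => //.
by rewrite scale0r add0r.
Qed.

Lemma near_eq_continuous (T U : topologicalType) (f g : T -> U) (x : T) :
  (\near x, f x = g x) -> {for x, continuous f} -> {for x, continuous g}.
Proof.
move=> fg cf; rewrite /prop_for /continuous_at -(nbhs_singleton fg).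
by apply: cvg_trans cf; exact: near_eq_cvg.
Qed.

Lemma is_derive1_continuous (R : realType) (f : R -> R) (x a : R) :
  is_derive x 1 f a -> {for x, continuous f}.
Proof.
by case=> df _; apply/differentiable_continuous/derivable1_diffP.
Qed.

(** * Radial functions of the squared norm *)

(** Radial functions are first written as functions of |x|^2, a polynomial in
the coordinates, so that no quotient appears in their partial derivatives. *)
Definition sqnorm {R : realType} {N : nat} (x : 'rV[R]_N) : R :=
  \sum_(i < N) x ord0 i ^+ 2.

Lemma is_derive_coord (R : realType) (N : nat) (x v : 'rV[R]_N) (i : 'I_N) :
  is_derive x v (fun y : 'rV[R]_N => y ord0 i) (v ord0 i).
Proof.
apply/is_derive_lineP.
rewrite (_ : (fun h : R => _) = (v ord0 i) \*: id + cst (x ord0 i)).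
  by apply: is_derive_eq; rewrite addr0 [LHS]mulr1.
by apply/funext => h; rewrite !mxE mulrC.
Qed.

Lemma is_derive_sqnorm (R : realType) (N : nat) (x : 'rV[R]_N) (j : 'I_N) :
  is_derive x (delta_mx ord0 j : 'rV[R]_N) sqnorm (2 * x ord0 j).
Proof.
rewrite (_ : sqnorm = \sum_(i < N) (fun y : 'rV[R]_N => y ord0 i) ^+ 2).
  have D i := @is_derive_coord R N x (delta_mx ord0 j) i.
  apply: is_derive_eq.
  rewrite (bigD1 j) //= big1 => [|i ij]; last first.
    by rewrite mxE (negbTE ij) andbF scaler0.
  by rewrite mxE !eqxx addr0 [LHS]mulr1 expr1.
by apply/funext => y; rewrite fct_sumE.
Qed.

Lemma continuous_sqnorm (R : realType) (N : nat) :
  continuous (@sqnorm R N).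
Proof.
apply: continuous_big => [|i _]; first exact: add_continuous.
move=> x; apply: (@continuous_comp _ _ _ (fun y : 'rV[R]_N => y ord0 i)
  (fun z : R => z ^+ 2)).
  exact: coord_continuous.
exact: exprn_continuous.
Qed.

Lemma near_sqnorm_gt (R : realType) (N : nat) (a : R) (x : 'rV[R]_N) :
  a < sqnorm x -> \near x, a < sqnorm x.
Proof. by move=> ax; exact: (cvgr_gt _ (@continuous_sqnorm R N x)). Qed.

Section Radial.
Context {R : realType} {N : nat} {a : R} {f f1 f2 : R -> R}.
Hypothesis df : forall q, a < q -> is_derive q 1 f (f1 q).
Hypothesis df1 : forall q, a < q -> is_derive q 1 f1 (f2 q).
Hypothesis cf2 : forall q, a < q -> {for q, continuous f2}.

Lemma is_derive_radial (x : 'rV[R]_N) (i : 'I_N) : a < sqnorm x ->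
  is_derive x (delta_mx ord0 i : 'rV[R]_N) (f \o sqnorm)
    (2 * x ord0 i * f1 (sqnorm x)).
Proof.
move=> ax; rewrite mulrC.
exact: (is_derive_comp_real (df ax) (is_derive_sqnorm x i)).
Qed.

Lemma partial_radial (x : 'rV[R]_N) (i : 'I_N) : a < sqnorm x ->
  partial i (f \o sqnorm) x = 2 * x ord0 i * f1 (sqnorm x).
Proof. by move=> /is_derive_radial D; rewrite /partial; case: (D i). Qed.

(** The formula for the first partial derivatives is only known where
[a < sqnorm x]; since this is an open condition, it can be differentiated
once more. *)
Lemma is_derive_partial_radial (x : 'rV[R]_N) (i j : 'I_N) : a < sqnorm x ->
  is_derive x (delta_mx ord0 j : 'rV[R]_N) (partial i (f \o sqnorm))
    (2 * (i == j)%:R * f1 (sqnorm x)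
     + 4 * x ord0 i * x ord0 j * f2 (sqnorm x)).
Proof.
move=> ax.
apply: (@near_eq_is_derive _ _ _
  (2 \*: ((fun y : 'rV[R]_N => y ord0 i) * (f1 \o sqnorm)))).
  near=> y; rewrite partial_radial; last by near: y; exact: near_sqnorm_gt.
  by rewrite -mulrA.
have D1 := is_derive_comp_real (df1 ax) (is_derive_sqnorm x j).
have D2 := is_derive_coord x (delta_mx ord0 j) i.
apply: is_derive_eq.
rewrite mxE eqxx /= /GRing.scale /=; ring.
Unshelve. all: by end_near. Qed.

Lemma partial_partial_radial (x : 'rV[R]_N) (i j : 'I_N) : a < sqnorm x ->
  partial j (partial i (f \o sqnorm)) x =
  2 * (i == j)%:R * f1 (sqnorm x) + 4 * x ord0 i * x ord0 j * f2 (sqnorm x).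
Proof.
by move=> ax; rewrite {1}/partial; case: (is_derive_partial_radial i j ax).
Qed.

Lemma continuous_radial (x : 'rV[R]_N) :
  a < sqnorm x -> {for x, continuous (f \o sqnorm)}.
Proof.
move=> ax; apply: continuous_comp; first exact: continuous_sqnorm.
exact: is_derive1_continuous (df ax).
Qed.

Lemma C2_radial (Om : set 'rV[R]_N) :
  (forall x, Om x -> a < sqnorm x) -> C2_on Om (f \o sqnorm).
Proof.
move=> aOm x /aOm ax; have cq := @continuous_sqnorm R N x.
have cf1 : {for x, continuous (f1 \o sqnorm)}.
  apply: continuous_comp => //.
  exact: is_derive1_continuous (df1 ax).
have cf2q : {for x, continuous (f2 \o sqnorm)}.
  by apply: continuous_comp => //; exact: cf2.
have cx k : {for x, continuous (fun y : 'rV[R]_N => y ord0 k)}.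
  exact: coord_continuous.
have c_ (c : R) : {for x, continuous (fun _ : 'rV[R]_N => c)}.
  exact: cst_continuous.
split=> [|i|i j]; first exact: continuous_radial.
- split; first by case: (is_derive_radial i ax).
  apply: near_eq_continuous (continuousM (continuousM (c_ 2) (cx i)) cf1).
  near=> y; rewrite partial_radial //.
  by near: y; exact: near_sqnorm_gt.
- split; first by case: (is_derive_partial_radial i j ax).
  apply: near_eq_continuous (continuousD
    (continuousM (c_ (2 * (i == j)%:R)) cf1)
    (continuousM (continuousM (continuousM (c_ 4) (cx i)) (cx j)) cf2q)).
  near=> y; rewrite partial_partial_radial //.
  by near: y; exact: near_sqnorm_gt.
Unshelve. all: by end_near. Qed.

Lemma laplacian_radial (x : 'rV[R]_N) : a < sqnorm x ->
  laplacian (f \o sqnorm) x =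
  4 * sqnorm x * f2 (sqnorm x) + 2 * N%:R * f1 (sqnorm x).
Proof.
move=> ax; rewrite /laplacian.
rewrite (eq_bigr (fun i => 2 * f1 (sqnorm x)
  + 4 * f2 (sqnorm x) * x ord0 i ^+ 2)); last first.
  by move=> i _; rewrite partial_partial_radial // eqxx /=; ring.
rewrite big_split /= sumr_const card_ord -mulr_natr -mulr_sumr -/(sqnorm x).
ring.
Qed.

End Radial.

(** * Radial functions of the logarithm of the norm *)

(** Applied to |x|^2, this is ln |x|. *)
Definition half_ln {R : realType} (q : R) : R := ln q / 2.

Lemma half_ln_gt0 (R : realType) (q : R) : 1 < q -> 0 < half_ln q.
Proof. by move=> q1; rewrite divr_gt0 // ln_gt0. Qed.

Lemma is_derive_half_ln (R : realType) (q : R) :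
  1 < q -> is_derive q 1 half_ln (2 * q)^-1.
Proof.
move=> q1; have q0 : 0 < q by lra.
have D := is_derive1_ln q0.
rewrite (_ : half_ln = 2^-1 \*: @ln R).
  by apply: is_derive_eq; rewrite invfM.
by apply/funext => t; rewrite /half_ln mulrC.
Qed.

Section LogRadial.
Context {R : realType} {N : nat} {G G1 G2 : R -> R}.
Hypothesis dG : forall t : R, 0 < t -> is_derive t 1 G (G1 t).
Hypothesis dG1 : forall t : R, 0 < t -> is_derive t 1 G1 (G2 t).
Hypothesis cG2 : forall t : R, 0 < t -> {for t, continuous G2}.

Let f1 (q : R) : R := G1 (half_ln q) / (2 * q).
Let f2 (q : R) : R := (G2 (half_ln q) - 2 * G1 (half_ln q)) / (4 * q ^+ 2).

Lemma is_derive_log (q : R) : 1 < q -> is_derive q 1 (G \o half_ln) (f1 q).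
Proof.
move=> q1; apply: is_derive1_comp; last exact: is_derive_half_ln.
exact: dG (half_ln_gt0 q1).
Qed.

Lemma is_derive_log1 (q : R) : 1 < q -> is_derive q 1 f1 (f2 q).
Proof.
move=> q1; have q0 : q != 0 by lra.
have DG := is_derive1_comp (dG1 (half_ln_gt0 q1)) (is_derive_half_ln q1).
have D2 : is_derive q (1 : R) (2 \*: id) (2 *: 1) by exact: is_deriveZ.
have DV : is_derive q (1 : R) (fun y : R => (2 * y)^-1) (- (2 * q) ^- 2 *: (2 *: 1)).
  by apply: is_deriveV => //; rewrite mulf_neq0.
apply: (is_derive_eq (is_deriveM DG DV)).
rewrite /f2 /GRing.scale /=; field.
by rewrite q0.
Qed.

Lemma continuous_log2 (q : R) : 1 < q -> {for q, continuous f2}.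
Proof.
move=> q1; have q0 : q != 0 by lra.
have t0 := half_ln_gt0 q1.
have ct : {for q, continuous half_ln}.
  exact: is_derive1_continuous (is_derive_half_ln q1).
have c1 : {for q, continuous (G1 \o half_ln)}.
  apply: continuous_comp => //.
  exact: is_derive1_continuous (dG1 t0).
have c2 : {for q, continuous (G2 \o half_ln)}.
  by apply: continuous_comp => //; exact: cG2.
have cc (c : R) : {for q, continuous (fun _ : R => c)} by exact: cst_continuous.
apply: (continuousM (continuousB c2 (continuousM (cc 2) c1))).
apply: continuousV; first by rewrite mulf_neq0 // expf_neq0.
exact: (continuousM (cc 4) (@exprn_continuous _ 2 q)).
Qed.

Let u : 'rV[R]_N -> R := (G \o half_ln) \o sqnorm.

Lemma C2_log_radial (Om : set 'rV[R]_N) :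
  (forall x, Om x -> 1 < sqnorm x) -> C2_on Om u.
Proof. exact: C2_radial is_derive_log is_derive_log1 continuous_log2 _. Qed.

Lemma continuous_log_radial (x : 'rV[R]_N) :
  1 < sqnorm x -> {for x, continuous u}.
Proof. exact: continuous_radial is_derive_log _. Qed.

(** In the variable t = ln |x| the radial Laplacian has constant coefficients
up to the factor |x|^-2: with q = |x|^2, [laplacian_radial] gives
4 q f2 + 2 N f1, where f1 = G' / (2 q) and f2 = (G'' - 2 G') / (4 q^2). *)
Lemma laplacian_log_radial (x : 'rV[R]_N) : 1 < sqnorm x ->
  laplacian u x =
  (G2 (half_ln (sqnorm x)) + (N%:R - 2) * G1 (half_ln (sqnorm x))) / sqnorm x.
Proof.
move=> x1; rewrite (laplacian_radial is_derive_log is_derive_log1) //.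
have x0 : sqnorm x != 0 by lra.
by rewrite /f1 /f2; field.
Qed.

End LogRadial.

(** * Reduction to an ordinary differential inequality *)

Lemma sqnormE (R : realType) (N : nat) (x : 'rV[R]_N) : sqnorm x = enorm x ^+ 2.
Proof. by rewrite sqr_sqrtr // sumr_ge0 // => i _; rewrite sqr_ge0. Qed.

Lemma continuous_enorm (R : realType) (N : nat) : continuous (@enorm R N).
Proof.
move=> x; apply: (@continuous_comp _ _ _ (@sqnorm R N) Num.sqrt).
  exact: continuous_sqnorm.
exact: sqrt_continuous.
Qed.

Lemma closure_exterior_domain (R : realType) (N : nat) (l : R) :
  closure (exterior_domain N l) `<=` [set x | l <= enorm x].
Proof.
rewrite closureE; apply: smallest_sub.
  apply: (@preimage_closed _ _ (@enorm R N) [set y | l <= y]).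
    by move=> x _; exact: continuous_enorm.
  exact: closed_ge.
by move=> x /= /negP; rewrite -ltNge => /ltW.
Qed.

(** The radius is l = e^L.  Every point of the closure of the domain then has
ln |x| >= L > 1, so the bounds on G beyond 1 give positivity and boundedness
in the domain and the sign on its boundary, and the differential inequality is
the one for - Delta u multiplied by |x|^2. *)
Lemma log_radial_supersolution (R : realType) (N : nat) (beta tau p L M : R)
    (G G1 G2 : R -> R) :
  1 < L ->
  (forall t : R, 0 < t -> is_derive t 1 G (G1 t)) ->
  (forall t : R, 0 < t -> is_derive t 1 G1 (G2 t)) ->
  (forall t : R, 0 < t -> {for t, continuous G2}) ->
  (forall t : R, 1 < t -> 0 < G t <= M) ->
  (forall t : R, L < t -> expR ((beta + 2) * t) * t `^ tau * G t `^ p <=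
     - (G2 t + (N%:R - 2) * G1 t)) ->
  exists2 l : R, expR 1 < l &
    exists u : 'rV[R]_N -> R,
      positive_bounded_supersolution (exterior_domain N l)
        (log_weight_nonlinearity beta tau p) u.
Proof.
move=> L1 dG dG1 cG2 GM GL.
exists (expR L); first by rewrite ltr_expR.
exists ((G \o half_ln) \o sqnorm).
have polar (x : 'rV[R]_N) : expR L <= enorm x -> exists t,
    [/\ L <= t, enorm x = expR t, half_ln (sqnorm x) = t & 1 < sqnorm x].
  move=> Lx; have x0 : 0 < enorm x by apply: lt_le_trans Lx; exact: expR_gt0.
  exists (ln (enorm x)); split.
  - by rewrite -ler_expR lnK.
  - by rewrite lnK.
  - by rewrite sqnormE /half_ln lnXn // mulr2n; field.
  - rewrite sqnormE expr_gt1 ?ltW //; apply: lt_le_trans Lx.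
    by rewrite expR_gt1; lra.
have ext (x : 'rV[R]_N) : exterior_domain N (expR L) x -> exists t,
    [/\ L < t, enorm x = expR t, half_ln (sqnorm x) = t & 1 < sqnorm x].
  move=> /= /negP; rewrite -ltNge => Lx.
  have [t [_ xt tx x1]] := polar x (ltW Lx).
  by exists t; split => //; rewrite -ltr_expR -xt.
split; first split.
- by apply: C2_log_radial dG dG1 cG2 _ _ => x /ext[t []].
- apply: continuous_in_subspaceT => x /set_mem /closure_exterior_domain /= Lx.
  by have [t [_ _ _ x1]] := polar x Lx; exact: continuous_log_radial dG _ _.
- move=> x /ext[t [Lt _ tx _]]; rewrite /= tx.
  by have /andP[] := GM t (lt_trans L1 Lt).
- move=> x /ext[t [Lt xt tx x1]].
  rewrite (laplacian_log_radial dG dG1) // /log_weight_nonlinearity /= tx xt.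
  rewrite expRK -expRM sqnormE xt -mulNr ler_pdivlMr ?exprn_gt0 ?expR_gt0 //.
  apply: le_trans (GL t Lt); rewrite le_eqVlt; apply/orP; left; apply/eqP.
  by rewrite mulrDl expRD expRM_natl [t * beta]mulrC; ring.
- move=> x [] /closure_exterior_domain /= /polar[t [Lt _ -> _]] _.
  by have /andP[/ltW] := GM t (lt_le_trans L1 Lt).
exists M; split; first exact: num_real.
move=> y My x /ext[t [Lt _ tx _]]; rewrite /= tx.
have /andP[G0 GtM] := GM t (lt_trans L1 Lt).
by rewrite ger0_norm ?(le_trans GtM) ?ltW.
Qed.

(** Factoring out e^(-s t), whose value s = N - 2 corresponds to the fundamental
solution, conjugates G'' + (N - 2) G' into
g'' + (N - 2 - 2 s) g' - s (N - 2 - s) g and leaves a function g that can be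
kept between 1 and 2. *)
Lemma twisted_supersolution (R : realType) (N : nat) (beta tau p s L : R)
    (g g1 g2 : R -> R) :
  0 <= s -> 1 < L ->
  (forall t : R, 0 < t -> is_derive t 1 g (g1 t)) ->
  (forall t : R, 0 < t -> is_derive t 1 g1 (g2 t)) ->
  (forall t : R, 0 < t -> {for t, continuous g2}) ->
  (forall t : R, 1 < t -> 1 <= g t <= 2) ->
  (forall t : R, L < t ->
     expR (- (s * (p - 1) - (beta + 2)) * t) * t `^ tau * g t `^ p <=
     s * (N%:R - 2 - s) * g t - (N%:R - 2 - 2 * s) * g1 t - g2 t) ->
  exists2 l : R, expR 1 < l &
    exists u : 'rV[R]_N -> R,
      positive_bounded_supersolution (exterior_domain N l)
        (log_weight_nonlinearity beta tau p) u.
Proof.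
move=> s0 L1 dg dg1 cg2 g12 gL.
pose E (t : R) := expR (- s * t).
have dE (t : R) : is_derive t 1 E (- s * E t).
  have D : is_derive t (1 : R) (- s \*: id) (- s *: 1) by exact: is_deriveZ.
  apply: (is_derive_eq (is_derive1_comp (is_derive_expR _) D)).
  by rewrite [_ *: 1]mulr1 mulrC.
have cE (t : R) : {for t, continuous E}.
  exact: is_derive1_continuous (dE t).
have cc (c t : R) : {for t, continuous (fun _ : R => c)}.
  exact: cst_continuous.
apply: (@log_radial_supersolution R N beta tau p L 2
  (fun t => E t * g t)
  (fun t => E t * (g1 t - s * g t))
  (fun t => E t * (g2 t - 2 * s * g1 t + s ^+ 2 * g t))) => //.
- move=> t t0; apply: (is_derive_eq (is_deriveM (dE t) (dg t t0))).
  by rewrite /GRing.scale /=; ring.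
- move=> t t0.
  have Dsg : is_derive t 1 (s \*: g) (s *: g1 t).
    by have D := dg t t0; exact: is_deriveZ.
  apply: (is_derive_eq (is_deriveM (dE t) (is_deriveB (dg1 t t0) Dsg))).
  rewrite [LHS](_ : _ =
    E t * (g2 t - s * g1 t) + (g1 t - s * g t) * (- s * E t)) //.
  by ring.
- move=> t t0.
  have cg : {for t, continuous g}.
    exact: is_derive1_continuous (dg t t0).
  have cg1 : {for t, continuous g1}.
    exact: is_derive1_continuous (dg1 t t0).
  exact: (continuousM (cE t) (continuousD (continuousB (cg2 t t0)
    (continuousM (cc (2 * s) t) cg1)) (continuousM (cc (s ^+ 2) t) cg))).
- move=> t t1; have /andP[g1t g2t] := g12 t t1.
  have E0 : 0 < E t by exact: expR_gt0.
  have E1 : E t <= 1 by rewrite expR_le1 mulNr oppr_le0 mulr_ge0 //; lra.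
  by apply/andP; split; nra.
- move=> t Lt.
  have /andP[g1t _] := g12 t (lt_trans L1 Lt).
  have E0 : 0 < E t by exact: expR_gt0.
  rewrite powRM ?(ltW E0) //; last by lra.
  rewrite [E t `^ p](_ : _ = expR (- s * t * p)); last by rewrite expRM.
  rewrite [leRHS](_ : _ = E t * (s * (N%:R - 2 - s) * g t
    - (N%:R - 2 - 2 * s) * g1 t - g2 t)); last by ring.
  rewrite [leLHS](_ : _ = E t * (expR (- (s * (p - 1) - (beta + 2)) * t)
    * t `^ tau * g t `^ p)); first by rewrite ler_pM2l //; exact: gL.
  rewrite /E !mulrA -expRD; congr (_ * _).
  by rewrite mulrAC -expRD; congr (expR _ * _); ring.
Qed.

(** * Two decay estimates *)

(** After taking logarithms, it suffices to bound ln t by a line of small slope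
k: indeed ln k + ln t = ln (k t) <= k t. *)
Lemma expR_beats_powR (R : realType) (tau delta c : R) : 0 < delta -> 0 < c ->
  exists2 L : R, 1 < L &
    forall t : R, L < t -> expR (- delta * t) * t `^ tau <= c.
Proof.
move=> d0 c0; pose T := `|tau|; have T0 : 0 <= T by exact: normr_ge0.
(* With this slope, tau * ln t uses up at most half of the decay
   delta * t, up to a constant. *)
pose k := delta / (2 * (T + 1)).
have k0 : 0 < k by rewrite divr_gt0 // mulr_gt0 //; lra.
have Tk : T * k <= delta / 2.
  have -> : delta / 2 = (T + 1) * k by rewrite /k; field; lra.
  by nra.
exists (Num.max 2 (2 * (- T * ln k - ln c) / delta)).
  by rewrite lt_max; apply/orP; left; lra.
move=> t; rewrite gt_max => /andP[t2]; rewrite ltr_pdivrMr // => tL.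
rewrite /powR gt_eqF; last by lra.
rewrite -expRD -[leRHS]lnK // ler_expR.
have lnt0 : 0 <= ln t by apply: ln_ge0; lra.
have lnkt : ln k + ln t <= k * t.
  by rewrite -lnM ?posrE //; [apply/ltW/ln_sublinear; rewrite mulr_gt0|]; lra.
have tT : tau * ln t <= T * ln t by rewrite ler_wpM2r // ler_norm.
have : T * (ln k + ln t) <= T * (k * t) by rewrite ler_wpM2l.
have : T * k * t <= delta / 2 * t by rewrite ler_wpM2r //; lra.
lra.
Qed.

Lemma powRN_small (R : realType) (eps c : R) : 0 < eps -> 0 < c ->
  exists2 L : R, 1 < L & forall t : R, L < t -> t `^ (- eps) <= c.
Proof.
move=> e0 c0; exists (Num.max 2 (expR (- ln c / eps))).
  by rewrite lt_max; apply/orP; left; lra.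
move=> t; rewrite gt_max => /andP[t2 tL].
have t0 : 0 < t by lra.
rewrite /powR gt_eqF // -[leRHS]lnK // ler_expR.
move: tL; rewrite -[X in _ < X -> _]lnK // ltr_expR ltr_pdivrMr //; nra.
Qed.

(** * The two cases *)

(** Here u = |x|^-s with s = N - 2 - eta: a positive constant s * eta is
available on the right-hand side, and strict supercriticality leaves room for
a small eta. *)
Lemma supercritical_supersolution (R : realType) (N : nat) (beta tau p : R) :
  (3 <= N)%N -> critical_exponent N beta < p ->
  exists2 l : R, expR 1 < l &
    exists u : 'rV[R]_N -> R,
      positive_bounded_supersolution (exterior_domain N l)
        (log_weight_nonlinearity beta tau p) u.
Proof.
move=> N3; have m1 : 1 <= N%:R - 2 :> R.
  by move: N3; rewrite -(ler_nat R); lra.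
rewrite /critical_exponent ltr_pdivrMr; last by lra.
set m := N%:R - 2 in m1 *; move=> Hp.
pose d := m * (p - 1) - (beta + 2).
have d0 : 0 < d by move: Hp; rewrite /d /m; lra.
pose P := `|p - 1|; have P0 : 0 <= P by exact: normr_ge0.
(* At most m / 2, to keep s = m - eta positive; the other bound keeps more than
   half of the gap d, whatever the sign of p - 1. *)
pose eta := Num.min (m / 2) (d / (2 * (P + 1))).
have eta0 : 0 < eta.
  by rewrite lt_min !divr_gt0 ?mulr_gt0 //; lra.
have etam : eta <= m / 2 by rewrite ge_min lexx.
have etad : eta * (P + 1) <= d / 2.
  rewrite -ler_pdivlMr; last by lra.
  by rewrite ge_min; apply/orP; right; rewrite invfM mulrA.
have etaP : eta * (p - 1) <= eta * P by rewrite ler_wpM2l ?ler_norm ?ltW.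
have dpos : 0 < (m - eta) * (p - 1) - (beta + 2).
  by move: d0 etad etaP; rewrite /d; nra.
have cpos : 0 < (m - eta) * (m - (m - eta)) by rewrite mulr_gt0; lra.
have [L L1 HL] := expR_beats_powR tau dpos cpos.
apply: (@twisted_supersolution R N beta tau p (m - eta) L
  (fun=> 1) (fun=> 0) (fun=> 0)) => //.
- by lra.
- by move=> t _; exact: cst_continuous.
- by move=> t _; apply/andP; split; lra.
- by move=> t /HL; rewrite powR1 !mulr0 !subr0 !mulr1.
Qed.

(** Here u = |x|^-(N - 2) (2 - (ln |x|)^-eps).  The correction contributes
(N - 2) eps t^(-eps - 1) to - |x|^N Delta u, which dominates t^tau for
large t as soon as eps < - tau - 1; such a positive eps exists because
tau < -1. *)
Lemma critical_supersolution (R : realType) (N : nat) (beta tau p : R) :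
  (3 <= N)%N -> p = critical_exponent N beta -> tau < -1 ->
  exists2 l : R, expR 1 < l &
    exists u : 'rV[R]_N -> R,
      positive_bounded_supersolution (exterior_domain N l)
        (log_weight_nonlinearity beta tau p) u.
Proof.
move=> N3 pE tau1; have m1 : 1 <= N%:R - 2 :> R.
  by move: N3; rewrite -(ler_nat R); lra.
pose m : R := N%:R - 2.
have d0 : m * (p - 1) - (beta + 2) = 0.
  by rewrite pE /critical_exponent /m; field; lra.
(* The midpoint of the admissible range 0 < eps < - tau - 1. *)
pose eps := - (tau + 1) / 2.
have eps0 : 0 < eps by rewrite /eps; lra.
have K0 : 0 < (2 : R) `^ `|p| by exact: powR_gt0.
have [L L1 HL] := powRN_small eps0 (divr_gt0 eps0 K0).
have dpow (a t : R) : 0 < t -> is_derive t 1 (fun y : R => y `^ a)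
    (a * t `^ (a - 1)).
  exact: (@is_derive1_powR R).
apply: (@twisted_supersolution R N beta tau p m L
  (fun t => 2 - t `^ (- eps)) (fun t => eps * t `^ (- eps - 1))
  (fun t => eps * ((- eps - 1) * t `^ (- eps - 1 - 1)))) => //.
- by rewrite /m; lra.
- move=> t t0.
  have D := is_deriveB (is_derive_cst (2 : R) t 1) (dpow (- eps) t t0).
  by apply: (is_derive_eq D); ring.
- move=> t t0; have D := dpow (- eps - 1) t t0.
  exact: is_deriveZ.
- move=> t t0.
  have cp : {for t, continuous (fun y : R => y `^ (- eps - 1 - 1))}.
    exact: is_derive1_continuous (dpow (- eps - 1 - 1) t t0).
  have cc (c : R) : {for t, continuous (fun _ : R => c)}.
    exact: cst_continuous.
  exact: (continuousM (cc eps) (continuousM (cc (- eps - 1)) cp)).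
- move=> t t1.
  have : t `^ (- eps) <= 1.
    by rewrite -[leRHS](powRr0 t) ler_powR //; lra.
  have := powR_ge0 t (- eps).
  by move=> ? ?; apply/andP; split; lra.
- move=> t Lt; rewrite -/m d0 oppr0 mul0r expR0 mul1r subrr mulr0 mul0r.
  have t1 : 1 < t by lra.
  have te := HL t Lt.
  have te0 := powR_ge0 t (- eps).
  have te1 : t `^ (- eps) <= 1 by rewrite -[leRHS](powRr0 t) ler_powR //; lra.
  have A0 := powR_ge0 t (- eps - 1).
  have B0 := powR_ge0 t (- eps - 1 - 1).
  set g := 2 - t `^ (- eps).
  (* Through `|p|, because p may be negative. *)
  have gp : g `^ p <= 2 `^ `|p|.
    apply: (@le_trans _ _ (g `^ `|p|)).
      by apply: ler_powR; [rewrite /g; lra|exact: ler_norm].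
    by apply: ge0_ler_powR => //; rewrite ?nnegrE /g; lra.
  have -> : tau = (- eps - 1) + (- eps) by rewrite /eps; field.
  rewrite powRD; last by apply/implyP => _; rewrite gt_eqF //; lra.
  have X : t `^ (- eps) * g `^ p <= eps.
    apply: (le_trans (ler_pM te0 (powR_ge0 _ _) te gp)).
    by rewrite divfK // gt_eqF.
  rewrite -mulrA.
  have := ler_wpM2l A0 X.
  have : 0 <= eps * ((eps + 1) * t `^ (- eps - 1 - 1)).
    by rewrite !mulr_ge0 //; lra.
  have : 0 <= (m - 1) * (eps * t `^ (- eps - 1)).
    by rewrite !mulr_ge0 //; rewrite /m; lra.
  lra.
Qed.

Theorem proposition4p2 (R : realType) (N : nat) (beta p tau : R) :
  (3 <= N)%N ->
  critical_exponent N beta < p \/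
  (p = critical_exponent N beta /\ tau < -1) ->
  exists2 l : R, expR 1 < l &
    exists u : 'rV[R]_N -> R,
      positive_bounded_supersolution (exterior_domain N l)
        (log_weight_nonlinearity beta tau p) u.
Proof.
move=> N3 [pc|[pc tau1]]; first exact: supercritical_supersolution.
exact: critical_supersolution.
Qed.
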